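(* There are two $5$-dimensional Levi decomposable subalgebras of $\mathfrak{so}(4,\mathbb{C})$, up to inner automorphism. They are $$(A_1\oplus K_2)^1=\langle x_1,y_1,h_1\rangle\oplus\langle x_2,h_2\rangle,\qquad (A_1\oplus K_2)^2=\langle x_2,y_2,h_2\rangle\oplus\langle x_1,h_1\rangle.$$ That is, every $5$-dimensional Levi decomposable subalgebra of $\mathfrak{so}(4,\mathbb{C})$ is equivalent to exactly one of these two.
   Context: A Levi decomposable algebra is a finite-dimensional Lie algebra with a nontrivial decomposition as a semidirect sum of a semisimple Lie algebra with a solvable ideal (both the semisimple part and the solvable part nonzero). $\mathfrak{so}(4,\mathbb{C})\cong\mathfrak{sl}(2,\mathbb{C})\oplus\mathfrak{sl}(2,\mathbb{C})$ is realized as the Lie algebra of $4\times4$ complex block diagonal matrices with two traceless $2\times 2$ diagonal blocks. With $E_{ij}$ the $4\times 4$ matrix units, its Chevalley basis is $x_1=E_{12}$, $y_1=E_{21}$, $h_1=E_{11}-E_{22}$, $x_2=E_{34}$, $y_2=E_{43}$, $h_2=E_{33}-E_{44}$. The notation $\langle\cdots\rangle$ denotes complex linear span. The inner automorphisms of $\mathfrak{so}(4,\mathbb{C})$ are the maps $X\mapsto AXA^{-1}$ with $A\in SL(2,\mathbb{C})\times SL(2,\mathbb{C})$ (block diagonal $4\times4$ matrices with both $2\times2$ blocks of determinant $1$). Two subalgebras $S,S'$ are equivalent (up to inner automorphism), written $S\sim S'$, if $\psi(S)=S'$ for some inner automorphism $\psi$ of $\mathfrak{so}(4,\mathbb{C})$.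 ($A_1$ denotes the type of $\mathfrak{sl}(2,\mathbb{C})$ and $K_2$ the $2$-dimensional Lie algebra with basis $z_1,z_2$ and $[z_1,z_2]=z_1$.) *)

(* Defs.v *)
From HB Require Import structures.
From mathcomp Require Import all_boot all_order all_algebra.

Set Implicit Arguments.
Unset Strict Implicit.
Unset Printing Implicit Defensive.

Import GRing.Theory.
Local Open Scope ring_scope.

(* Lie algebras of matrices are linear subspaces of 'M[K]_n that are closed
   under the commutator bracket. *)

Section MatrixLieAlgebras.

Variables (K : fieldType) (n : nat).
Implicit Types (X Y : 'M[K]_n) (U V W S I L N : {vspace 'M[K]_n}).

Definition lie X Y : 'M[K]_n := X *m Y - Y *m X.

(* [U, V], the span of all brackets; by bilinearity bases suffice
   (see lie_space_subP). *)
Definition lie_space U V : {vspace 'M[K]_n} :=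
  <<[seq lie X Y | X <- vbasis U, Y <- vbasis V]>>%VS.

Lemma lie_space_subP U V W :
  reflect (forall X Y, X \in U -> Y \in V -> lie X Y \in W)
          (lie_space U V <= W)%VS.
Proof.
apply: (iffP span_subvP) => [subW X Y XU YV | subW Z /allpairsP].
  rewrite (coord_vbasis XU) (coord_vbasis YV) /lie.
  rewrite mulmx_suml mulmx_sumr -sumrB; apply: memv_suml => i _.
  rewrite mulmx_sumr mulmx_suml -sumrB; apply: memv_suml => j _.
  rewrite -!scalemxAl -!scalemxAr !scalerA [_ j _ * _]mulrC -scalerBr.
  apply: memvZ; apply: subW; apply: allpairs_f.
    by apply: mem_nth; rewrite size_tuple.
  by apply: mem_nth; rewrite size_tuple.
by case=> [[X Y] /= [/vbasis_mem XU /vbasis_mem YV ->]]; apply: subW.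
Qed.

Definition lie_subalgebra S : Prop := (lie_space S S <= S)%VS.

Definition lie_ideal I S : Prop := (I <= S)%VS /\ (lie_space S I <= I)%VS.

Definition derived_series S (k : nat) : {vspace 'M[K]_n} :=
  iter k (fun U => lie_space U U) S.

Definition lie_solvable S : Prop := exists k, derived_series S k = 0%VS.

(* The radical vanishes. The zero algebra is semisimple in this sense. *)
Definition lie_semisimple S : Prop :=
  forall I, lie_ideal I S -> lie_solvable I -> I = 0%VS.

Definition levi_decomposable S : Prop :=
  exists L N,
    [/\ lie_subalgebra L, lie_semisimple L & L <> 0%VS] /\
    [/\ lie_ideal N S, lie_solvable N & N <> 0%VS] /\
    (L + N = S)%VS /\ (L :&: N = 0)%VS.

Definition lie_direct_sum U V : Prop :=
  (U :&: V = 0)%VS /\ lie_space U V = 0%VS.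

(* K_2: two-dimensional with basis z1, z2 and [z1, z2] = z1. *)
Definition is_K2 U : Prop :=
  exists z1 z2, basis_of U [:: z1; z2] /\ lie z1 z2 = z1.

End MatrixLieAlgebras.

(* Only the restriction of f to U matters; every linear map defined on U
   extends to the whole matrix space. *)
Definition lie_isomorphic (K : fieldType) (m n : nat)
    (U : {vspace 'M[K]_m}) (V : {vspace 'M[K]_n}) : Prop :=
  exists f : 'Hom('M[K]_m, 'M[K]_n),
    [/\ (f @: U = V)%VS,
        {in U &, injective f} &
        {in U &, forall X Y, f (lie X Y) = lie (f X) (f Y)}].

Definition sl2 (K : fieldType) : {vspace 'M[K]_2} :=
  lker (linfun (mxtrace : 'M[K]_2 -> K^o)).

Lemma mem_sl2 (K : fieldType) (X : 'M[K]_2) : (X \in sl2 K) = (\tr X == 0).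
Proof. by rewrite memv_ker lfunE. Qed.

Definition is_A1 (K : fieldType) (n : nat) (U : {vspace 'M[K]_n}) : Prop :=
  lie_isomorphic U (sl2 K).

Section SO4.

Variable K : fieldType.

Definition in_so4 (X : 'M[K]_(2 + 2)) : Prop :=
  exists A B : 'M[K]_2,
    [/\ X = block_mx A 0 0 B, \tr A = 0 & \tr B = 0].

Definition so4_subalgebra (S : {vspace 'M[K]_(2 + 2)}) : Prop :=
  {in S, forall X, in_so4 X} /\ lie_subalgebra S.

(* Conjugation X |-> A X A^-1. *)
Definition conjugation (A : 'M[K]_(2 + 2)) : 'End('M[K]_(2 + 2)) :=
  linfun (mulmxr (invmx A) \o mulmx A).

Lemma conjugationE A X : conjugation A X = A *m X *m invmx A.
Proof. by rewrite lfunE. Qed.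

Definition so4_equiv (S S' : {vspace 'M[K]_(2 + 2)}) : Prop :=
  exists P Q : 'M[K]_2,
    [/\ \det P = 1, \det Q = 1 & (conjugation (block_mx P 0 0 Q) @: S = S')%VS].

(* Matrix units with the usual indices 1, ..., 4. *)
Definition E (i j : nat) : 'M[K]_(2 + 2) :=
  delta_mx (inord i.-1 : 'I_4) (inord j.-1 : 'I_4).

Definition x1 := E 1 2.
Definition y1 := E 2 1.
Definition h1 := E 1 1 - E 2 2.
Definition x2 := E 3 4.
Definition y2 := E 4 3.
Definition h2 := E 3 3 - E 4 4.

Definition A1_1 : {vspace 'M[K]_(2 + 2)} := <<[:: x1; y1; h1]>>%VS.
Definition K2_1 : {vspace 'M[K]_(2 + 2)} := <<[:: x2; h2]>>%VS.
Definition A1_2 : {vspace 'M[K]_(2 + 2)} := <<[:: x2; y2; h2]>>%VS.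
Definition K2_2 : {vspace 'M[K]_(2 + 2)} := <<[:: x1; h1]>>%VS.

Definition A1K2_1 : {vspace 'M[K]_(2 + 2)} := (A1_1 + K2_1)%VS.
Definition A1K2_2 : {vspace 'M[K]_(2 + 2)} := (A1_2 + K2_2)%VS.

Definition levi_so4_dim (d : nat) (S : {vspace 'M[K]_(2 + 2)}) : Prop :=
  [/\ so4_subalgebra S, levi_decomposable S & \dim S = d].

End SO4.

(* Main.v *)
(** A codimension-one subspace S of so(4) = sl2 + sl2 is the kernel of a
    functional (phi, phi').  If S is a subalgebra and phi' <> 0, then every
    element of the first factor extends to an element of S, so closure under
    the bracket makes ker phi an ideal of sl2, which forces phi = 0; thus one
    of the two components vanishes.  The kernel of the other one is a
    two-dimensional subalgebra of sl2, so the functional is isotropic for the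
    form dual to the Killing form, and an explicit element of SL2 conjugates
    its kernel to the upper triangular matrices.  The two normal forms are not
    equivalent because only one of them contains the whole first factor, which
    conjugation preserves. *)

From HB Require Import structures.
Require Import Defs.
From mathcomp Require Import all_boot all_order all_algebra.
From mathcomp Require Import reals ring.
From mathcomp.real_closed Require Import complex.

Set Implicit Arguments.
Unset Strict Implicit.
Unset Printing Implicit Defensive.

Import GRing.Theory.
Local Open Scope ring_scope.

(** * Bracket calculus, copies of $K_2$, and direct sums of subalgebras *)

Section LieGeneral.

Variables (K : fieldType).

Section Bracket.

Variables (n : nat).
Implicit Types (X Y Z : 'M[K]_n) (U V W L N : {vspace 'M[K]_n}).

Lemma lieDl X Y Z : lie (X + Y) Z = lie X Z + lie Y Z.
Proof. by rewrite /lie mulmxDl mulmxDr opprD addrACA. Qed.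

Lemma lieDr X Y Z : lie Z (X + Y) = lie Z X + lie Z Y.
Proof. by rewrite /lie mulmxDl mulmxDr opprD addrACA. Qed.

Lemma lieZl a X Y : lie (a *: X) Y = a *: lie X Y.
Proof. by rewrite /lie -scalemxAl -scalemxAr scalerBr. Qed.

Lemma lieZr a X Y : lie X (a *: Y) = a *: lie X Y.
Proof. by rewrite /lie -scalemxAl -scalemxAr scalerBr. Qed.

Lemma liexx X : lie X X = 0.
Proof. exact: subrr. Qed.

Lemma lieC X Y : lie X Y = - lie Y X.
Proof. by rewrite /lie opprB. Qed.

Lemma memv_lie U V X Y : X \in U -> Y \in V -> lie X Y \in lie_space U V.
Proof. by move=> XU YV; apply: (lie_space_subP U V _ (subvv _)). Qed.

Lemma lie_spaceS U U' V V' :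
  (U <= U')%VS -> (V <= V')%VS -> (lie_space U V <= lie_space U' V')%VS.
Proof.
move=> /subvP sU /subvP sV; apply/lie_space_subP => X Y /sU XU /sV YV.
exact: memv_lie.
Qed.

Lemma derived_series_sub U k : lie_subalgebra U -> (derived_series U k <= U)%VS.
Proof.
move=> subU; elim: k => [|k IHk] /=; first exact: subvv.
exact: subv_trans (lie_spaceS IHk IHk) subU.
Qed.

Lemma mem_span2 (vT : vectType K) (u v w : vT) :
  reflect (exists a b, w = a *: u + b *: v) (w \in <<[:: u; v]>>%VS).
Proof.
rewrite span_cons span_seq1; apply: (iffP memv_addP) => [[_ /vlineP[a ->]]|[a [b ->]]].
  by case=> _ /vlineP[b ->] ->; exists a, b.
by exists (a *: u); rewrite ?memvZ ?memv_line //; exists (b *: v); rewrite ?memvZ ?memv_line.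
Qed.

(** By bilinearity $[a z_1 + b z_2,\, c z_1 + d z_2] = (ad - bc) z_1$. *)
Lemma K2_bracket U (z1 z2 : 'M[K]_n) :
  basis_of U [:: z1; z2] -> lie z1 z2 = z1 -> (lie_space U U <= <[z1]>)%VS.
Proof.
move=> /span_basis <- br; apply/lie_space_subP => _ _ /mem_span2[a [b ->]] /mem_span2[c [d ->]].
rewrite !(lieDl, lieDr, lieZl, lieZr) !liexx br (lieC z2) br !scaler0 addr0 add0r.
by rewrite !(memvD, memvZ, memvN) ?memv_line.
Qed.

Lemma K2_subalgebra U : is_K2 U -> lie_subalgebra U.
Proof.
case=> z1 [z2 [bU br]]; apply: subv_trans (K2_bracket bU br) _.
by rewrite -memvE (basis_mem bU) ?inE ?eqxx.
Qed.

Lemma K2_solvable U : is_K2 U -> lie_solvable U.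
Proof.
(* The first derived space lies in the line through $z_1$, and brackets within a line vanish. *)
case=> z1 [z2 [bU br]]; exists 2; apply/eqP; rewrite -subv0 /=.
apply: subv_trans (lie_spaceS (K2_bracket bU br) (K2_bracket bU br)) _.
apply/lie_space_subP => _ _ /vlineP[a ->] /vlineP[b ->].
by rewrite lieZl lieZr liexx !scaler0 mem0v.
Qed.

Lemma dim_K2 U : is_K2 U -> \dim U = 2.
Proof. by case=> z1 [z2 [/size_basis ->]]. Qed.

(** For $A \in L$ and $B, Y \in N$ the cross term $[A, Y]$ vanishes, so $[A + B, Y] = [B, Y]$, which
    lies in $N$. *)
Lemma lie_direct_sum_ideal L N :
  lie_subalgebra N -> lie_direct_sum L N -> lie_ideal N (L + N).
Proof.
move=> /lie_space_subP subN [_ /eqP]; rewrite -subv0 => /lie_space_subP LN0.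
split; first exact: addvSr.
apply/lie_space_subP => _ Y /memv_addP[A AL [B BN ->]] YN.
move: (LN0 A Y AL YN); rewrite memv0 lieDl => /eqP->.
by rewrite add0r; apply: subN.
Qed.

Lemma lie_direct_sum_subalgebra L N :
  lie_subalgebra L -> lie_subalgebra N -> lie_direct_sum L N ->
  lie_subalgebra (L + N).
Proof.
move=> /lie_space_subP subL subN dLN; have [_ idN] := lie_direct_sum_ideal subN dLN.
move/lie_space_subP: idN => idN.
apply/lie_space_subP => X Y XS /memv_addP[A AL [B BN ->]].
rewrite lieDr memvD //; last by apply: (subvP (addvSr L N)); apply: idN.
case/memv_addP: XS => A' A'L [B' B'N ->]; rewrite lieDl memvD //.
  by apply: (subvP (addvSl L N)); apply: subL.
by rewrite lieC memvN; apply: (subvP (addvSr L N)); apply: idN => //; apply: (subvP (addvSl L N)).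
Qed.

Lemma lie_direct_sumC U V :
  lie_direct_sum U V -> lie_direct_sum V U.
Proof.
case=> cap /eqP; rewrite -subv0 => /lie_space_subP UV; split; first by rewrite capvC.
apply/eqP; rewrite -subv0; apply/lie_space_subP => X Y XV YU.
by rewrite lieC memvN; apply: UV.
Qed.

End Bracket.

(** * Transport along a linear map that preserves brackets and is injective on a subspace *)

Section Image.

Variables (m n : nat) (f : 'Hom('M[K]_m, 'M[K]_n)) (D : {vspace 'M[K]_m}).
Hypothesis f_lie : {in D &, forall X Y, f (lie X Y) = lie (f X) (f Y)}.
Hypothesis f_inj : {in D &, injective f}.

Lemma limg_lie_space U V :
  (U <= D)%VS -> (V <= D)%VS -> (f @: lie_space U V = lie_space (f @: U) (f @: V))%VS.
Proof.
move=> /subvP sU /subvP sV; apply: subv_anti; apply/andP; split.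
  apply/subvP => _ /memv_imgP[Z Zl ->].
  rewrite memv_preim; move: Z Zl; apply/subvP.
  apply/lie_space_subP => X Y XU YV; rewrite -memv_preim f_lie ?(sU _ XU) ?(sV _ YV) //.
  by rewrite memv_lie ?memv_img.
apply/lie_space_subP => _ _ /memv_imgP[X XU ->] /memv_imgP[Y YV ->].
by rewrite -f_lie ?(sU _ XU) ?(sV _ YV) // memv_img ?memv_lie.
Qed.

Lemma limg_solvable I :
  (I <= D)%VS -> lie_subalgebra I -> lie_solvable I -> lie_solvable (f @: I).
Proof.
(* Once zero is written as the image of the last derived term, it suffices that [f] commutes with
   each term of the derived series. *)
move=> sID subI [k Ik0]; exists k; rewrite -(limg0 f) -Ik0.
elim: k {Ik0} => //= k ->.
by rewrite limg_lie_space // (subv_trans (derived_series_sub _ _)).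
Qed.

Lemma limg_subalgebra U :
  (U <= D)%VS -> lie_subalgebra U -> lie_subalgebra (f @: U).
Proof. by move=> sU subU; rewrite /lie_subalgebra -limg_lie_space // limgS. Qed.

(** A solvable ideal of [D] has a solvable ideal of the image as its image. That image is zero, and
    injectivity brings this back to [D]. *)
Lemma semisimple_limg : lie_semisimple (f @: D) -> lie_semisimple D.
Proof.
move=> ssD I [sID idI] solI; apply/eqP; rewrite -subv0; apply/subvP => X XI.
have subI : lie_subalgebra I by apply: subv_trans idI; apply: lie_spaceS.
have fI0 : (f @: I = 0)%VS.
  apply: ssD; last exact: limg_solvable.
  by split; rewrite -?limg_lie_space ?limgS.
have: f X \in (f @: I)%VS by rewrite memv_img.
rewrite fI0 !memv0 => /eqP fX0; apply/eqP/f_inj.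
- exact: (subvP sID).
- exact: mem0v.
by rewrite fX0 linear0.
Qed.

Lemma dim_limg_inj : \dim (f @: D) = \dim D.
Proof.
apply: limg_dim_eq; apply/eqP; rewrite -subv0; apply/subvP => X.
rewrite memv_cap memv_ker memv0 => /andP[XD /eqP fX0].
by apply/eqP/f_inj; rewrite ?mem0v ?fX0 ?linear0.
Qed.

End Image.

Lemma limg_K2 m n (e : 'Hom('M[K]_m, 'M[K]_n)) (U : {vspace 'M[K]_m}) :
  (forall X Y : 'M[K]_m, e (lie X Y) = lie (e X) (e Y)) -> injective e ->
  is_K2 U -> is_K2 (e @: U).
Proof.
move=> e_lie e_inj [z1 [z2 [bU br]]]; exists (e z1), (e z2).
split; last by rewrite -e_lie br.
apply: (limg_basis_of (X := [:: z1; z2])) bU.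
have /eqP-> : lker e == 0%VS by apply/lker0P.
by rewrite capv0.
Qed.

End LieGeneral.

(** * The algebra $\mathfrak{sl}_2$ in coordinates, and its simplicity *)

Section SL2.

Variable K : fieldType.
Hypothesis two_neq0 : 2 != 0 :> K.
Implicit Types (p q r a b c : K) (X Y : 'M[K]_2).

(** The element $p h + q x + r y$. In these coordinates, identities in $\mathfrak{sl}_2$ become
    polynomial identities. *)
Definition sl2mx p q r : 'M[K]_2 :=
  \matrix_(i, j) if i == 0 then if j == 0 then p else q
                 else if j == 0 then r else - p.

Lemma ord2P (k : 'I_2) : k = 0 \/ k = 1.
Proof. by case: k => [[|[|//]] lt_k2]; [left | right]; apply: val_inj. Qed.

Lemma mx2P X Y :
  X 0 0 = Y 0 0 -> X 0 1 = Y 0 1 -> X 1 0 = Y 1 0 -> X 1 1 = Y 1 1 -> X = Y.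
Proof.
move=> e00 e01 e10 e11; apply/matrixP => i j.
by case: (ord2P i) => ->; case: (ord2P j) => ->.
Qed.

Lemma big_ord2 (F : 'I_2 -> K) : \sum_i F i = F 0 + F 1.
Proof. by rewrite !big_ord_recl big_ord0 addr0; congr (F _ + F _); apply: val_inj. Qed.

Lemma sl2mxK X : X \in sl2 K -> X = sl2mx (X 0 0) (X 0 1) (X 1 0).
Proof.
rewrite mem_sl2 /mxtrace big_ord2 addrC addr_eq0 => /eqP trX.
by apply: mx2P; rewrite !mxE.
Qed.

Lemma sl2mx_sl2 p q r : sl2mx p q r \in sl2 K.
Proof. by rewrite mem_sl2 /mxtrace big_ord2 !mxE /= subrr. Qed.

Lemma sl2mxP X : reflect (exists p q r, X = sl2mx p q r) (X \in sl2 K).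
Proof.
apply: (iffP idP) => [/sl2mxK|[p [q [r ->]]]]; last exact: sl2mx_sl2.
by exists (X 0 0), (X 0 1), (X 1 0).
Qed.

Lemma sl2mxD p q r p' q' r' :
  sl2mx p q r + sl2mx p' q' r' = sl2mx (p + p') (q + q') (r + r').
Proof. by apply: mx2P; rewrite !mxE //= opprD. Qed.

Lemma sl2mxZ a p q r : a *: sl2mx p q r = sl2mx (a * p) (a * q) (a * r).
Proof. by apply: mx2P; rewrite !mxE //= mulrN. Qed.

Lemma sl2mx0 : sl2mx 0 0 0 = 0.
Proof. by apply: mx2P; rewrite !mxE //= oppr0. Qed.

Lemma det_mx2 (P : 'M[K]_2) : \det P = P 0 0 * P 1 1 - P 0 1 * P 1 0.
Proof.
rewrite (expand_det_row _ 0) big_ord2 /cofactor !det_mx11 !mxE /= expr0 expr1.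
rewrite mul1r mulN1r mulrN; congr (_ * P _ _ - _ * P _ _); exact: val_inj.
Qed.

Lemma lie_sl2mx p q r p' q' r' :
  lie (sl2mx p q r) (sl2mx p' q' r') =
  sl2mx (q * r' - r * q') (2 * (p * q' - q * p')) (2 * (r * p' - p * r')).
Proof.
by apply: mx2P; rewrite !mxE !big_ord2 !mxE /=; ring.
Qed.

Lemma sl2_span : sl2 K = <<[:: sl2mx 0 1 0; sl2mx 0 0 1; sl2mx 1 0 0]>>%VS.
Proof.
apply: subv_anti; apply/andP; split; last first.
  by apply/span_subvP => X; rewrite !inE => /or3P[] /eqP->; apply: sl2mx_sl2.
apply/subvP => _ /sl2mxP[p [q [r ->]]].
have -> : sl2mx p q r = q *: sl2mx 0 1 0 + r *: sl2mx 0 0 1 + p *: sl2mx 1 0 0.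
  by rewrite !sl2mxZ !sl2mxD; congr sl2mx; ring.
by rewrite !memvD ?memvZ ?memv_span ?inE ?eqxx ?orbT.
Qed.

(** Rank-nullity for the trace on a space of dimension 4. The trace has rank 1, because a diagonal
    matrix unit has trace 1. *)
Lemma dim_sl2 : \dim (sl2 K) = 3.
Proof.
have := limg_ker_dim (linfun (mxtrace : 'M[K]_2 -> K^o)) fullv.
rewrite capfv dimvf dim_matrix -/(sl2 K) => dimE.
suff dim1 : \dim (limg (linfun (mxtrace : 'M[K]_2 -> K^o))) = 1.
  by move: dimE; rewrite dim1 addn1 => -[].
have dim_le1 := dimvS (subvf (limg (linfun (mxtrace : 'M[K]_2 -> K^o))));
rewrite dimvf in dim_le1; apply/eqP; rewrite eqn_leq dim_le1 lt0n dimv_eq0.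
apply/eqP => lim0; have := memv_img (linfun (mxtrace : 'M[K]_2 -> K^o)) (memvf (delta_mx 0 0)).
rewrite lim0 memv0 lfunE /= /mxtrace big_ord2 !mxE /= addr0.
by rewrite oner_eq0.
Qed.

Lemma sl2_subalgebra : lie_subalgebra (sl2 K).
Proof.
apply/lie_space_subP => _ _ /sl2mxP[p [q [r ->]]] /sl2mxP[p' [q' [r' ->]]].
by rewrite lie_sl2mx sl2mx_sl2.
Qed.

(** From $x$ one gets $h = [-y, x]$, and then $y = [y/2, h]$, where 2 has to be inverted. *)
Lemma sl2_generated (I : {vspace 'M[K]_2}) :
  (lie_space (sl2 K) I <= I)%VS -> sl2mx 0 1 0 \in I -> (sl2 K <= I)%VS.
Proof.
move=> /lie_space_subP idI eI.
have hI : sl2mx 1 0 0 \in I.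
  have := idI _ _ (sl2mx_sl2 0 0 (- 1)) eI.
  by rewrite lie_sl2mx (_ : sl2mx _ _ _ = sl2mx 1 0 0) //; congr sl2mx; ring.
have fI : sl2mx 0 0 1 \in I.
  have := idI _ _ (sl2mx_sl2 0 0 (2^-1)) hI.
  rewrite lie_sl2mx (_ : sl2mx _ _ _ = sl2mx 0 0 1) //; congr sl2mx; by field.
rewrite sl2_span; apply/span_subvP => X.
by rewrite !inE => /or3P[] /eqP->.
Qed.

(** Bracketing $x$ with a nonzero element $p h + q x + r y$ of the ideal once gives $r h - 2p x$,
    and twice gives $-2r x$. So $x$ is obtained from the double bracket if $r \neq 0$, from the
    single one if $r = 0$ and $p \neq 0$, and from the element itself otherwise. *)
Lemma sl2_ideal (I : {vspace 'M[K]_2}) :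
  lie_ideal I (sl2 K) -> I != 0%VS -> I = sl2 K.
Proof.
case=> [sI idI] nzI; apply: subv_anti; rewrite sI sl2_generated //.
move/lie_space_subP: idI => idI.
have XI := memv_pick I; have /sl2mxP[p [q [r Xpqr]]] := subvP sI _ XI.
rewrite -vpick0 in nzI; rewrite Xpqr in XI nzI.
have eX := idI _ _ (sl2mx_sl2 0 1 0) XI.
have eeX := idI _ _ (sl2mx_sl2 0 1 0) eX.
rewrite !lie_sl2mx in eX eeX.
have [r0|r0] := eqVneq r 0; last first.
  rewrite (_ : sl2mx 0 1 0 = (- 2 * r)^-1 *: sl2mx 0 (- 2 * r) 0); last first.
    by rewrite sl2mxZ mulr0 mulVf // mulf_neq0 ?oppr_eq0.
  rewrite memvZ //; move: eeX; congr (_ \in I); congr sl2mx; ring.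
have [p0|p0] := eqVneq p 0; last first.
  rewrite (_ : sl2mx 0 1 0 = (- 2 * p)^-1 *: sl2mx 0 (- 2 * p) 0); last first.
    by rewrite sl2mxZ mulr0 mulVf // mulf_neq0 ?oppr_eq0.
  rewrite memvZ //; move: eX; rewrite r0; congr (_ \in I); congr sl2mx; ring.
rewrite p0 r0 in XI nzI; have [q0|q0] := eqVneq q 0.
  by move: nzI; rewrite q0 sl2mx0 eqxx.
rewrite (_ : sl2mx 0 1 0 = q^-1 *: sl2mx 0 q 0) ?memvZ //.
by rewrite sl2mxZ mulr0 mulVf.
Qed.

(** The derived algebra is an ideal, and it is nonzero since $[h, x] = 2x$. Simplicity does the
    rest. *)
Lemma sl2_perfect : lie_space (sl2 K) (sl2 K) = sl2 K.
Proof.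
apply: sl2_ideal.
  by split; [apply: sl2_subalgebra | apply: lie_spaceS (subvv _) sl2_subalgebra].
apply/eqP => br0.
have := memv_lie (sl2mx_sl2 1 0 0) (sl2mx_sl2 0 1 0).
rewrite br0 memv0 lie_sl2mx => /eqP/matrixP/(_ 0 1)/eqP.
by rewrite !mxE /= mul0r subr0 !mulr1 (negPf two_neq0).
Qed.

(** By simplicity a nonzero ideal is the whole algebra, whose derived series stays constant at
    dimension 3. *)
Lemma sl2_semisimple : lie_semisimple (sl2 K).
Proof.
move=> I idI [k Ik0]; apply/eqP; apply: contraT => nzI.
move: Ik0; rewrite (sl2_ideal idI nzI).
have -> : derived_series (sl2 K) k = sl2 K by elim: k => //= k ->; apply: sl2_perfect.
by move/(congr1 (fun U : {vspace 'M[K]_2} => \dim U)); rewrite dim_sl2 dimv0.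
Qed.

Lemma A1_semisimple n (U : {vspace 'M[K]_n}) : is_A1 U -> lie_semisimple U.
Proof.
case=> f [fU f_inj f_lie]; apply: semisimple_limg f_lie f_inj _.
by rewrite fU; apply: sl2_semisimple.
Qed.

Lemma dim_A1 n (U : {vspace 'M[K]_n}) : is_A1 U -> \dim U = 3.
Proof. by case=> f [fU f_inj _]; rewrite -(dim_limg_inj f_inj) fU dim_sl2. Qed.

(** The type $A_1$ asks for a map towards $\mathfrak{sl}_2$, so the isomorphism supplied is the left
    inverse of [e]. *)
Lemma limg_sl2_A1 n (e : 'Hom('M[K]_2, 'M[K]_n)) :
  (forall X Y, e (lie X Y) = lie (e X) (e Y)) -> injective e ->
  is_A1 (e @: sl2 K) /\ lie_subalgebra (e @: sl2 K).
Proof.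
move=> e_lie e_inj; split; last first.
  by apply: limg_subalgebra (subvv _) sl2_subalgebra => X Y _ _; apply: e_lie.
have eK : cancel e (e^-1)%VF by apply: lker0_lfunK; apply/lker0P.
exists (e^-1)%VF; split.
- rewrite -limg_comp; apply: subv_anti; apply/andP; split; apply/subvP => X.
    by case/memv_imgP=> Y Ysl ->; rewrite comp_lfunE /= eK.
  by move=> Xsl; apply/memv_imgP; exists X; rewrite // comp_lfunE /= eK.
- by move=> _ _ /memv_imgP[X _ ->] /memv_imgP[Y _ ->]; rewrite !eK => ->.
- by move=> _ _ /memv_imgP[X _ ->] /memv_imgP[Y _ ->]; rewrite -e_lie !eK.
Qed.

Lemma A1_K2_levi n (L N : {vspace 'M[K]_n}) :
  is_A1 L -> lie_subalgebra L -> is_K2 N -> lie_direct_sum L N ->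
  [/\ lie_subalgebra (L + N), levi_decomposable (L + N) & \dim (L + N) = 5].
Proof.
move=> A1L subL K2N dLN; have [capLN _] := dLN; have subN := K2_subalgebra K2N.
have neq0 (U : {vspace 'M[K]_n}) : (0 < \dim U)%N -> U <> 0%VS.
  by move=> + U0; rewrite U0 dimv0.
split; first exact: lie_direct_sum_subalgebra.
- exists L, N; split.
    by split; [|exact: A1_semisimple|apply: neq0; rewrite dim_A1].
  split; last by [].
  by split; [exact: lie_direct_sum_ideal|exact: K2_solvable|apply: neq0; rewrite dim_K2].
- by rewrite dimv_disjoint_sum // dim_A1 // dim_K2.
Qed.

(** * Linear functionals on $\mathfrak{sl}_2$ and their kernels *)

(* A functional on sl2 is given by its coordinates (a, b, c) in the basis dual
   to (h, x, y). *)
Lemma bracket_kernel_eq0 a b c :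
  (forall p q r p' q' r', a * p + b * q + c * r = 0 ->
     a * (q * r' - r * q') + b * (2 * (p * q' - q * p')) +
     c * (2 * (r * p' - p * r')) = 0) ->
  [/\ a = 0, b = 0 & c = 0].
Proof.
move=> H.
(* The kernel contains $b h - a x$ and $[b h - a x, x] = 2b x$, so $2b^2 = 0$. In the same way $c h
   - a y$ and $y$ give $c = 0$. Then $x$ is in the kernel, and $[x, y] = h$ gives $a = 0$. *)
have b0 : b = 0.
  have /H : a * b + b * - a + c * 0 = 0 by ring.
  move/(_ 0 1 0) => e; have : 2 * b ^+ 2 = 0 by rewrite -e; ring.
  by move/eqP; rewrite mulf_eq0 (negPf two_neq0) sqrf_eq0 => /eqP.
have c0 : c = 0.
  have /H : a * c + b * 0 + c * - a = 0 by ring.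
  move/(_ 0 0 1) => e; have : 2 * c ^+ 2 = 0 by rewrite -[RHS]oppr0 -e; ring.
  by move/eqP; rewrite mulf_eq0 (negPf two_neq0) sqrf_eq0 => /eqP.
split=> //; have /H : a * 0 + b * 1 + c * 0 = 0 by rewrite b0; ring.
by move/(_ 0 0 1) => <-; rewrite b0 c0; ring.
Qed.

(** The quantity $D = a^2 + 4bc$ is, up to a scalar, the form dual to the Killing form. On the
    pairwise brackets of the kernel vectors $b h - a x$, $c h - a y$ and $c x - b y$ the functional
    takes the values $aD$, $bD$ and $cD$. All three vanish, so $D \neq 0$ would force $a = b = c =
    0$. *)
Lemma subalgebra_kernel_isotropic a b c :
  (a, b, c) != 0 ->
  (forall p q r p' q' r', a * p + b * q + c * r = 0 -> a * p' + b * q' + c * r' = 0 ->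
     a * (q * r' - r * q') + b * (2 * (p * q' - q * p')) +
     c * (2 * (r * p' - p * r')) = 0) ->
  a ^+ 2 + 4 * b * c = 0.
Proof.
move=> nz H; apply/eqP; apply: contraNT nz => D0.
have k1 : a * b + b * - a + c * 0 = 0 by ring.
have k2 : a * c + b * 0 + c * - a = 0 by ring.
have k3 : a * 0 + b * c + c * - b = 0 by ring.
have Da : a * (a ^+ 2 + 4 * b * c) = 0 by rewrite -(H _ _ _ _ _ _ k1 k2); ring.
have Db : b * (a ^+ 2 + 4 * b * c) = 0 by rewrite -(H _ _ _ _ _ _ k1 k3); ring.
have Dc : c * (a ^+ 2 + 4 * b * c) = 0 by rewrite -(H _ _ _ _ _ _ k2 k3); ring.
move: Da Db Dc => /eqP + /eqP + /eqP.
by rewrite !mulf_eq0 (negPf D0) !orbF => /eqP-> /eqP-> /eqP->.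
Qed.

Lemma functional_onto a b c t :
  (a, b, c) != 0 -> exists p q r, a * p + b * q + c * r = t.
Proof.
move=> nz; have [a0|a0] := eqVneq a 0; last first.
  by exists (t / a), 0, 0; field.
have [b0|b0] := eqVneq b 0; last first.
  by exists 0, (t / b), 0; field.
have [c0|c0] := eqVneq c 0; last first.
  by exists 0, 0, (t / c); field.
by move: nz; rewrite a0 b0 c0 eqxx.
Qed.

Lemma isotropic_functional_conj a b c :
  (a, b, c) != 0 -> a ^+ 2 + 4 * b * c = 0 ->
  exists2 P : 'M[K]_2, \det P = 1 &
    forall p q r, a * p + b * q + c * r = 0 -> (P *m sl2mx p q r *m invmx P) 1 0 = 0.
Proof.
have invE (P P' : 'M[K]_2) : P *m P' = 1%:M -> invmx P = P'.
  move=> PP'; have [uP _] := mulmx1_unit PP'.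
  by rewrite -[LHS]mulmx1 -PP' mulmxA mulVmx // mul1mx.
move=> nz disc; have [c0|c0] := eqVneq c 0.
  have a0 : a = 0 by apply/eqP; rewrite -sqrf_eq0 -disc c0 mulr0 addr0.
  have b0 : b != 0 by move: nz; rewrite a0 c0; apply: contra => /eqP->.
  (* Here the kernel is $q = 0$, the lower triangular matrices. The Weyl element with rows $(0, -1)$
     and $(1, 0)$ exchanges them with the upper triangular ones. *)
  pose P : 'M[K]_2 := \matrix_(i, j) if i == 0 then - (j != 0)%:R else (j == 0)%:R.
  pose P' : 'M[K]_2 := - P.
  have PP' : P *m P' = 1%:M.
    by apply: mx2P; rewrite !mxE !big_ord2 !mxE /=; ring.
  exists P.
    by rewrite det_mx2 !mxE /=; ring.
  move=> p q r; rewrite a0 c0 !mul0r add0r addr0 => /eqP.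
  rewrite mulf_eq0 (negPf b0) /= => /eqP->; rewrite (invE _ _ PP').
  rewrite !mxE !big_ord2 !mxE !big_ord2 !mxE /=; ring.
(* Conjugation by the lower unitriangular matrix with entry $u$ makes the lower left entry $r + 2up
   - u^2 q$. With this $u$ and $a^2 = -4bc$, it equals $(ap + bq + cr)/c$. *)
pose u := a / (2 * c).
pose P (v : K) : 'M[K]_2 := \matrix_(i, j) if i == j then 1 else v * (i != 0)%:R.
have PP' : P u *m P (- u) = 1%:M.
  by apply: mx2P; rewrite !mxE !big_ord2 !mxE /=; ring.
exists (P u).
  by rewrite det_mx2 !mxE /=; ring.
move=> p q r pqr0; rewrite (invE _ _ PP').
rewrite !mxE !big_ord2 !mxE !big_ord2 !mxE /=.
have nz4 : 4 * c ^+ 2 != 0.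
  by rewrite mulf_neq0 ?expf_neq0 // (_ : 4 = 2 * 2) ?mulf_neq0 //; ring.
(* Multiplying by $4c^2$ clears the denominators of $u$ and $u^2$. *)
apply: (mulfI nz4); rewrite mulr0.
transitivity (4 * c * (a * p + b * q + c * r) - q * (a ^+ 2 + 4 * b * c)).
  by rewrite /u; field; rewrite c0.
by rewrite pqr0 disc !mulr0 subrr.
Qed.

End SL2.

(** For a vector $v$ of [T] outside [S], one has $T = \langle v\rangle \oplus S$. The functional is
    the coordinate along $v$ of the projection onto $\langle v\rangle$ with kernel direction [S]. *)
Lemma hyperplane_functional (K : fieldType) (vT : vectType K) (S T : {vspace vT}) :
  (S <= T)%VS -> \dim T = (\dim S).+1 ->
  exists2 g : vT -> K, scalar g & (exists2 v, v \in T & g v != 0) /\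
    {in T, forall u, (u \in S) = (g u == 0)}.
Proof.
move=> sST dimT.
have /subvPn[v vinT vS] : ~~ (T <= S)%VS.
  by apply: contraTN (leqnn (\dim T)) => /dimvS; rewrite dimT ltnn.
have v0 : v != 0 by apply: contraNneq vS => ->; rewrite mem0v.
have cap0 : (<[v]> :&: S = 0)%VS.
  apply/eqP; rewrite -subv0; apply/subvP => w; rewrite memv_cap.
  case/andP=> /vlineP[k ->] kvS; have [->|k0] := eqVneq k 0.
    by rewrite scale0r mem0v.
  by case/negP: vS; rewrite -(scalerK k0 v) memvZ.
have TE : T = (<[v]> + S)%VS.
  apply/esym/eqP; rewrite eqEdim subv_add sST -memvE vinT.
  by rewrite /= dimv_disjoint_sum // dim_vline v0 dimT add1n leqnn.
pose f := daddv_pi <[v]> S.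
have fv : f v = v by rewrite daddv_pi_id ?memv_line.
pose g u : K := coord (in_tuple [:: v]) ord0 (f u).
have fE u : f u = g u *: v.
  have := memv_pi (<[v]>)%VS S u; rewrite -/f -span_seq1 -[[:: v]]/(in_tuple [:: v] : seq _).
  by move/coord_span=> {1}->; rewrite big_ord_recl big_ord0 addr0.
exists g; first by move=> k u w; rewrite /g !linearP.
have gf u : (g u == 0) = (f u == 0) by rewrite fE scaler_eq0 (negPf v0) orbF.
split; first by exists v; rewrite ?gf ?fv.
rewrite TE => u uT; rewrite gf; have := daddv_pi_add cap0 uT; rewrite -/f.
have cap0' : (S :&: <[v]> = 0)%VS by rewrite capvC.
move=> fu; apply/idP/eqP => [uS|fu0].
  by move: fu; rewrite (daddv_pi_id cap0' uS) => /(canRL (addrK _)); rewrite subrr.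
by rewrite -fu fu0 add0r memv_pi.
Qed.

(** * The two factors of $\mathfrak{so}(4)$ as diagonal blocks, and the two normal forms *)

Section SO4.

Variable K : fieldType.
Implicit Types (X Y : 'M[K]_2).

Definition ulblock X : 'M[K]_(2 + 2) := block_mx X 0 0 0.
Definition drblock X : 'M[K]_(2 + 2) := block_mx 0 0 0 X.

Fact ulblock_is_linear : linear ulblock.
Proof. by move=> a X Y; rewrite /ulblock scale_block_mx add_block_mx !scaler0 !addr0. Qed.

HB.instance Definition _ :=
  GRing.isLinear.Build K 'M[K]_2 'M[K]_(2 + 2) _ ulblock ulblock_is_linear.

Fact drblock_is_linear : linear drblock.
Proof. by move=> a X Y; rewrite /drblock scale_block_mx add_block_mx !scaler0 !addr0. Qed.

HB.instance Definition _ :=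
  GRing.isLinear.Build K 'M[K]_2 'M[K]_(2 + 2) _ drblock drblock_is_linear.

Let blockE (M N : 'M[K]_(2 + 2)) :
  (forall k l, [/\ M (lshift 2 k) (lshift 2 l) = N (lshift 2 k) (lshift 2 l),
    M (lshift 2 k) (rshift 2 l) = N (lshift 2 k) (rshift 2 l),
    M (rshift 2 k) (lshift 2 l) = N (rshift 2 k) (lshift 2 l) &
    M (rshift 2 k) (rshift 2 l) = N (rshift 2 k) (rshift 2 l)]) -> M = N.
Proof.
move=> MN; apply/matrixP => i j.
case: (split_ordP i) => k ->; case: (split_ordP j) => l ->;
  by case: (MN k l).
Qed.

(** Translates matrix units numbered from 1 into block form, so that the later arguments can work
    one factor at a time. *)
Lemma chevalley_blocks :
  [/\ x1 K = ulblock (sl2mx 0 1 0), y1 K = ulblock (sl2mx 0 0 1) &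
      h1 K = ulblock (sl2mx 1 0 0)] /\
  [/\ x2 K = drblock (sl2mx 0 1 0), y2 K = drblock (sl2mx 0 0 1) &
      h2 K = drblock (sl2mx 1 0 0)].
Proof.
split; split; apply: blockE => k l;
  case: (ord2P k) => ->; case: (ord2P l) => ->; split;
  rewrite ?(block_mxEul, block_mxEur, block_mxEdl, block_mxEdr) !mxE
          -!val_eqE /= !inordK //= ?subrr ?subr0 ?sub0r ?oppr0 //.
Qed.

(** The standard Borel subalgebra: traceless upper triangular matrices. *)
Definition borel : {vspace 'M[K]_2} := <<[:: sl2mx 0 1 0; sl2mx 1 0 0]>>%VS.

Lemma mem_borel X : X \in sl2 K -> (X \in borel) = (X 1 0 == 0).
Proof.
move=> Xsl; apply/mem_span2/eqP => [[a [b ->]]|X10].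
  by rewrite !mxE /= !mulr0 addr0.
exists (X 0 1), (X 0 0); rewrite {1}(sl2mxK Xsl) X10 !sl2mxZ sl2mxD.
by congr sl2mx; ring.
Qed.

Local Notation ul := (linfun ulblock).
Local Notation dr := (linfun drblock).

Lemma A1_1E : A1_1 K = (ul @: sl2 K)%VS.
Proof.
by have [[x y h] _] := chevalley_blocks; rewrite /A1_1 x y h sl2_span limg_span /= !lfunE. Qed.

Lemma A1_2E : A1_2 K = (dr @: sl2 K)%VS.
Proof.
by have [_ [x y h]] := chevalley_blocks; rewrite /A1_2 x y h sl2_span limg_span /= !lfunE. Qed.

Lemma K2_1E : K2_1 K = (dr @: borel)%VS.
Proof.
by have [_ [x y h]] := chevalley_blocks; rewrite /K2_1 x h limg_span /= !lfunE. Qed.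

Lemma K2_2E : K2_2 K = (ul @: borel)%VS.
Proof.
by have [[x y h] _] := chevalley_blocks; rewrite /K2_2 x h limg_span /= !lfunE. Qed.

Lemma lie_block (A B A' B' : 'M[K]_2) :
  lie (block_mx A 0 0 B : 'M[K]_(2 + 2)) (block_mx A' 0 0 B') =
  block_mx (lie A A') 0 0 (lie B B').
Proof.
rewrite /lie !mulmx_block !(mul0mx, mulmx0, addr0, add0r).
by rewrite opp_block_mx add_block_mx !oppr0 !addr0.
Qed.

Lemma lie_ulblock X Y : lie (ulblock X) (ulblock Y) = ulblock (lie X Y).
Proof. by rewrite lie_block liexx. Qed.

Lemma lie_drblock X Y : lie (drblock X) (drblock Y) = drblock (lie X Y).
Proof. by rewrite lie_block liexx. Qed.

Lemma lie_ul_drblock X Y : lie (ulblock X) (drblock Y) = 0.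
Proof. by rewrite lie_block /lie !(mul0mx, mulmx0) subrr block_mx0. Qed.

Lemma ul_dr_block X Y : ulblock X + drblock Y = block_mx X 0 0 Y.
Proof. by rewrite /ulblock /drblock add_block_mx !addr0 !add0r. Qed.

Lemma limg_lie_direct_sum U V : lie_direct_sum (ul @: U) (dr @: V).
Proof.
split; apply/eqP; rewrite -subv0.
  apply/subvP => X; rewrite memv_cap => /andP[/memv_imgP[A _ ->] /memv_imgP[B _]].
  rewrite !lfunE => /eq_block_mx[-> _ _ _].
  by rewrite /= /ulblock block_mx0 mem0v.
apply/lie_space_subP => _ _ /memv_imgP[A _ ->] /memv_imgP[B _ ->].
by rewrite !lfunE lie_ul_drblock mem0v.
Qed.

Lemma borel_K2 : 2 != 0 :> K -> is_K2 borel.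
Proof.
(* Since $[x, h] = -2x$, the pair $z_1 = x$, $z_2 = -h/2$ satisfies $[z_1, z_2] = z_1$. *)
move=> two_neq0; exists (sl2mx 0 1 0), (sl2mx (- 2^-1) 0 0); split; last first.
  by rewrite lie_sl2mx; congr sl2mx; field.
have half : - 2^-1 != 0 :> K by rewrite oppr_eq0 invr_eq0.
have borelE : borel = <<[:: sl2mx 0 1 0; sl2mx (- 2^-1) 0 0]>>%VS.
  have hE : sl2mx (- 2^-1) 0 0 = (- 2^-1) *: sl2mx 1 0 0 :> 'M[K]_2.
    by rewrite sl2mxZ mulr1 mulr0.
  apply: subv_anti; apply/andP; split; apply/span_subvP => X;
    rewrite !inE => /orP[] /eqP->.
  - by rewrite memv_span ?mem_head.
  - by rewrite -[sl2mx 1 0 0](scalerK half) -hE memvZ // memv_span // !inE eqxx orbT.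
  - by rewrite memv_span ?mem_head.
  - by rewrite hE memvZ // memv_span // !inE eqxx orbT.
rewrite basisEfree borelE subvv dim_span /= free_cons seq1_free span_seq1.
rewrite andbT; apply/andP; split.
  apply/negP => /vlineP[k /matrixP/(_ 0 1)/eqP].
  by rewrite !mxE /= mulr0 oner_eq0.
by apply/negP => /eqP/matrixP/(_ 0 0)/eqP; rewrite !mxE /= (negPf half).
Qed.

Hypothesis two_neq0 : 2 != 0 :> K.

Lemma ulblock_inj : injective ul.
Proof. by move=> X Y; rewrite !lfunE => /eq_block_mx[]. Qed.

Lemma drblock_inj : injective dr.
Proof. by move=> X Y; rewrite !lfunE => /eq_block_mx[]. Qed.

Lemma ul_lie X Y : ul (lie X Y) = lie (ul X) (ul Y).
Proof. by rewrite !lfunE /= lie_ulblock. Qed.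

Lemma dr_lie X Y : dr (lie X Y) = lie (dr X) (dr Y).
Proof. by rewrite !lfunE /= lie_drblock. Qed.

Lemma A1K2_1_structure :
  [/\ is_A1 (A1_1 K), lie_subalgebra (A1_1 K), is_K2 (K2_1 K) &
      lie_direct_sum (A1_1 K) (K2_1 K)].
Proof.
rewrite A1_1E K2_1E; have [] := limg_sl2_A1 ul_lie ulblock_inj.
split=> //; last exact: limg_lie_direct_sum.
by apply: limg_K2 dr_lie drblock_inj _; apply: borel_K2.
Qed.

Lemma A1K2_2_structure :
  [/\ is_A1 (A1_2 K), lie_subalgebra (A1_2 K), is_K2 (K2_2 K) &
      lie_direct_sum (A1_2 K) (K2_2 K)].
Proof.
rewrite A1_2E K2_2E; have [] := limg_sl2_A1 dr_lie drblock_inj.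
split=> //; last by apply: lie_direct_sumC; apply: limg_lie_direct_sum.
by apply: limg_K2 ul_lie ulblock_inj _; apply: borel_K2.
Qed.

(** The predicate [in_so4] as a subspace, which allows dimension counts. *)
Definition so4 : {vspace 'M[K]_(2 + 2)} := (A1_1 K + A1_2 K)%VS.

Lemma dim_so4 : \dim so4 = 6.
Proof.
have [A1 _ _ _] := A1K2_1_structure; have [A2 _ _ _] := A1K2_2_structure.
rewrite /so4 dimv_disjoint_sum ?(dim_A1 A1) ?(dim_A1 A2) //.
by rewrite A1_1E A1_2E; case: (limg_lie_direct_sum (sl2 K) (sl2 K)).
Qed.

Lemma mem_limg_blocks U V X Y :
  (block_mx X 0 0 Y \in (ul @: U + dr @: V)%VS) = (X \in U) && (Y \in V).
Proof.
apply/memv_addP/andP => [[_ /memv_imgP[A AU ->]] [_ /memv_imgP[B BV ->]]|[XU YV]].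
  by rewrite !lfunE /= ul_dr_block => /eq_block_mx[-> _ _ ->].
exists (ul X); rewrite ?memv_img //; exists (dr Y); rewrite ?memv_img //.
by rewrite !lfunE /= ul_dr_block.
Qed.

Lemma limg_blocksP U V (Z : 'M[K]_(2 + 2)) :
  Z \in (ul @: U + dr @: V)%VS ->
  exists X Y, [/\ Z = block_mx X 0 0 Y, X \in U & Y \in V].
Proof.
case/memv_addP=> _ /memv_imgP[A AU ->] [_ /memv_imgP[B BV ->] ->].
by exists A, B; rewrite !lfunE /= ul_dr_block.
Qed.

Lemma A1K2_1E : A1K2_1 K = (ul @: sl2 K + dr @: borel)%VS.
Proof. by rewrite /A1K2_1 A1_1E K2_1E. Qed.

Lemma A1K2_2E : A1K2_2 K = (ul @: borel + dr @: sl2 K)%VS.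
Proof. by rewrite /A1K2_2 A1_2E K2_2E addvC. Qed.

Lemma so4E : so4 = (ul @: sl2 K + dr @: sl2 K)%VS.
Proof. by rewrite /so4 A1_1E A1_2E. Qed.

Lemma borel_sub : (borel <= sl2 K)%VS.
Proof.
by apply/span_subvP => X; rewrite !inE => /orP[] /eqP->; apply: sl2mx_sl2.
Qed.

Lemma in_so4P (Z : 'M[K]_(2 + 2)) : in_so4 Z <-> Z \in so4.
Proof.
rewrite so4E; split=> [[A [B [-> trA trB]]]|/limg_blocksP[A [B [-> Asl Bsl]]]].
  by rewrite mem_limg_blocks !mem_sl2 trA trB eqxx.
by exists A, B; split=> //; apply/eqP; rewrite -mem_sl2.
Qed.

Lemma levi_A1K2_1 : levi_so4_dim 5 (A1K2_1 K).
Proof.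
have [A1 subA K2 dAK] := A1K2_1_structure.
have [sub levi dim5] := A1_K2_levi two_neq0 A1 subA K2 dAK.
split=> //; split=> // Z ZS; apply/in_so4P; move: Z ZS; apply/subvP.
by rewrite A1K2_1E so4E addvS // limgS // borel_sub.
Qed.

Lemma levi_A1K2_2 : levi_so4_dim 5 (A1K2_2 K).
Proof.
have [A1 subA K2 dAK] := A1K2_2_structure.
have [sub levi dim5] := A1_K2_levi two_neq0 A1 subA K2 dAK.
split=> //; split=> // Z ZS; apply/in_so4P; move: Z ZS; apply/subvP.
by rewrite A1K2_2E so4E addvS // limgS // borel_sub.
Qed.

(** * Block conjugation, and the invariant that separates the normal forms *)

Lemma conjugation_block (P Q X Y : 'M[K]_2) : \det P = 1 -> \det Q = 1 ->
  conjugation (block_mx P 0 0 Q) (block_mx X 0 0 Y) =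
  block_mx (P *m X *m invmx P) 0 0 (Q *m Y *m invmx Q).
Proof.
move=> detP detQ; rewrite conjugationE invmx_block_diag; last first.
  by rewrite unitmxE det_ublock detP detQ mulr1 unitr1.
by rewrite !mulmx_block !(mul0mx, mulmx0, addr0, add0r).
Qed.

Lemma conjugation_inj (P Q : 'M[K]_2) : \det P = 1 -> \det Q = 1 ->
  injective (conjugation (block_mx P 0 0 Q)).
Proof.
move=> detP detQ; have uPQ : block_mx P 0 0 Q \in unitmx.
  by rewrite unitmxE det_ublock detP detQ mulr1 unitr1.
move=> X Y; rewrite !conjugationE => /(can_inj (mulmxKV uPQ)).
exact: (can_inj (mulKmx uPQ)).
Qed.

Lemma conj_sl2 (P X : 'M[K]_2) : \det P = 1 -> X \in sl2 K -> P *m X *m invmx P \in sl2 K.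
Proof.
move=> detP; rewrite !mem_sl2 mxtrace_mulC mulmxA mulVmx ?mul1mx //.
by rewrite unitmxE detP unitr1.
Qed.

(** Block conjugation maps the first factor into itself, and the first normal form contains that
    factor. Injectivity pulls the membership back to [S]. *)
Lemma equiv_A1K2_1_contains (S : {vspace 'M[K]_(2 + 2)}) X :
  so4_equiv S (A1K2_1 K) -> X \in sl2 K -> block_mx X 0 0 0 \in S.
Proof.
case=> P [Q [detP detQ SE]] Xsl.
have: conjugation (block_mx P 0 0 Q) (block_mx X 0 0 0) \in A1K2_1 K.
  rewrite conjugation_block // A1K2_1E mem_limg_blocks conj_sl2 //.
  by rewrite mulmx0 mul0mx mem0v.
by rewrite -SE => /memv_imgP[Z ZS /(conjugation_inj detP detQ)->].
Qed.

Lemma equiv_A1K2_2_misses (S : {vspace 'M[K]_(2 + 2)}) :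
  so4_equiv S (A1K2_2 K) -> exists2 X, X \in sl2 K & block_mx X 0 0 0 \notin S.
Proof.
case=> P [Q [detP detQ SE]].
have uP : P \in unitmx by rewrite unitmxE detP unitr1.
pose y : 'M[K]_2 := sl2mx 0 0 1.
(* This witness is sent to $y$ by the conjugation, and $y$ is not upper triangular. *)
exists (invmx P *m y *m P).
  by rewrite mem_sl2 mxtrace_mulC mulmxA mulmxV // mul1mx -mem_sl2 sl2mx_sl2.
apply/negP => /(memv_img (conjugation (block_mx P 0 0 Q))).
rewrite SE conjugation_block // A1K2_2E mem_limg_blocks !mulmxA mulmxV // mul1mx.
by rewrite mulmxK // mem_borel ?sl2mx_sl2 // !mxE /= oner_eq0.
Qed.

Lemma not_equiv_both (S : {vspace 'M[K]_(2 + 2)}) :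
  so4_equiv S (A1K2_1 K) -> ~ so4_equiv S (A1K2_2 K).
Proof.
by move=> S1 /equiv_A1K2_2_misses[X Xsl /negP[]]; apply: equiv_A1K2_1_contains.
Qed.

End SO4.

(** * Subalgebras of dimension 5 and their reduction to normal form *)

Section Classification.

Variable K : fieldType.
Hypothesis two_neq0 : 2 != 0 :> K.

Local Notation ul := (linfun (@ulblock K)).
Local Notation dr := (linfun (@drblock K)).
Local Notation form a b c p q r := (a * p + b * q + c * r).

(** Dimension 5 is codimension one in $\mathfrak{so}(4)$. The six coefficients are the values of a
    defining functional on the Chevalley basis. *)
Lemma so4_hyperplane (S : {vspace 'M[K]_(2 + 2)}) :
  so4_subalgebra S -> \dim S = 5 ->
  exists a b c a' b' c',
    ((a, b, c) != 0 :> K * K * K) || ((a', b', c') != 0 :> K * K * K) /\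
    forall p q r p' q' r',
      (block_mx (sl2mx p q r) 0 0 (sl2mx p' q' r') \in S) =
      (form a b c p q r + form a' b' c' p' q' r' == 0).
Proof.
move=> [Sso4 _] dim5.
have sS : (S <= so4 K)%VS by apply/subvP => Z /Sso4/in_so4P.
have [g g_lin [[v vso4 gv] gS]] : exists2 g : 'M[K]_(2 + 2) -> K, scalar g &
    (exists2 v, v \in so4 K & g v != 0) /\
    {in so4 K, forall u, (u \in S) = (g u == 0)}.
  by apply: hyperplane_functional sS _; rewrite dim5 dim_so4.
have gD u w : g (u + w) = g u + g w by have := g_lin 1 u w; rewrite scale1r mul1r.
have g0 : g 0 = 0 by apply: (@addrI _ (g 0)); rewrite -gD !addr0.
have gZ k u : g (k *: u) = k * g u by have := g_lin k u 0; rewrite g0 !addr0.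
have gE (e : 'Hom('M[K]_2, 'M[K]_(2 + 2))) p q r : g (e (sl2mx p q r)) =
    form (g (e (sl2mx 1 0 0))) (g (e (sl2mx 0 1 0))) (g (e (sl2mx 0 0 1))) p q r.
  have -> : sl2mx p q r = p *: sl2mx 1 0 0 + q *: sl2mx 0 1 0 + r *: sl2mx 0 0 1.
    by rewrite !sl2mxZ !sl2mxD; congr sl2mx; ring.
  by rewrite !linearD !linearZ /= !gD !gZ; ring.
have gblock p q r p' q' r' : g (block_mx (sl2mx p q r) 0 0 (sl2mx p' q' r')) =
    g (ul (sl2mx p q r)) + g (dr (sl2mx p' q' r')).
  by rewrite -gD !lfunE /= ul_dr_block.
exists (g (ul (sl2mx 1 0 0))), (g (ul (sl2mx 0 1 0))), (g (ul (sl2mx 0 0 1))).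
exists (g (dr (sl2mx 1 0 0))), (g (dr (sl2mx 0 1 0))), (g (dr (sl2mx 0 0 1))).
split=> [|p q r p' q' r']; last first.
  by rewrite -!gE -gblock gS // so4E mem_limg_blocks !sl2mx_sl2.
(* If both triples vanished, the functional would be zero on all of $\mathfrak{so}(4)$, in
   particular at $v$. *)
rewrite -negb_and; apply: contra gv => /andP[/eqP[a0 b0 c0] /eqP[a0' b0' c0']].
move: vso4; rewrite so4E => /limg_blocksP[X [Y [-> /sl2mxP[p [q [r ->]]]]]].
move=> /sl2mxP[p' [q' [r' ->]]]; rewrite gblock (gE ul p q r) (gE dr p' q' r') a0 b0 c0 a0' b0' c0'.
by rewrite !mul0r !addr0.
Qed.

Lemma subalgebra5_functional (S : {vspace 'M[K]_(2 + 2)}) :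
  so4_subalgebra S -> \dim S = 5 ->
  exists a b c : K, [/\ (a, b, c) != 0, a ^+ 2 + 4 * b * c = 0 &
    (forall p q r p' q' r', block_mx (sl2mx p q r) 0 0 (sl2mx p' q' r') \in S ->
       form a b c p q r = 0) \/
    (forall p q r p' q' r', block_mx (sl2mx p q r) 0 0 (sl2mx p' q' r') \in S ->
       form a b c p' q' r' = 0)].
Proof.
move=> subS dim5; have [a [b [c [a' [b' [c' [nz memS]]]]]]] := so4_hyperplane subS dim5.
(* Closure of [S] under the bracket, read in coordinates. *)
have br p q r p' q' r' P Q R P' Q' R' :
    form a b c p q r + form a' b' c' p' q' r' = 0 ->
    form a b c P Q R + form a' b' c' P' Q' R' = 0 ->
    form a b c (q * R - r * Q) (2 * (p * Q - q * P)) (2 * (r * P - p * R)) +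
    form a' b' c' (q' * R' - r' * Q') (2 * (p' * Q' - q' * P'))
      (2 * (r' * P' - p' * R')) = 0.
  move=> /eqP XS /eqP YS; apply/eqP; rewrite -memS -!lie_sl2mx -lie_block.
  by case: subS => _ /lie_space_subP; apply; rewrite memS.
have [nz'|z'] := boolP ((a', b', c') != 0 :> K * K * K).
  have [a0 b0 c0] : [/\ a = 0, b = 0 & c = 0].
    apply: bracket_kernel_eq0 => // p q r P Q R pqr0.
    (* The second component is chosen to cancel the value of the first, so the pair lies in [S]. Its
       bracket with an element of [S] whose second component is zero again has second component
       zero. *)
    have [P' [Q' [R' PQR']]] := functional_onto (- form a b c P Q R) nz'.
    have k1 : form a b c p q r + form a' b' c' 0 0 0 = 0 by rewrite pqr0; ring.
    have k2 : form a b c P Q R + form a' b' c' P' Q' R' = 0 by rewrite PQR' subrr.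
    by rewrite -(br _ _ _ _ _ _ _ _ _ _ _ _ k1 k2); ring.
  exists a', b', c'; split=> //.
    (* Kernel vectors of the second functional, paired with zero in the first factor, lie in [S];
       hence this kernel is closed under the bracket. *)
    apply: subalgebra_kernel_isotropic nz' _ => p q r P Q R k1 k2.
    have e1 : form a b c 0 0 0 + form a' b' c' p q r = 0 by rewrite k1; ring.
    have e2 : form a b c 0 0 0 + form a' b' c' P Q R = 0 by rewrite k2; ring.
    by rewrite -(br _ _ _ _ _ _ _ _ _ _ _ _ e1 e2); ring.
  right=> p q r p' q' r'; rewrite memS a0 b0 c0 !mul0r !add0r.
  exact: eqP.
move: nz; rewrite (negPf z') orbF => nz.
move: z'; rewrite negbK => /eqP[a0 b0 c0].
exists a, b, c; split=> //.
  apply: subalgebra_kernel_isotropic nz _ => p q r P Q R k1 k2.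
  have e1 : form a b c p q r + form a' b' c' 0 0 0 = 0 by rewrite k1; ring.
  have e2 : form a b c P Q R + form a' b' c' 0 0 0 = 0 by rewrite k2; ring.
  by rewrite -(br _ _ _ _ _ _ _ _ _ _ _ _ e1 e2); ring.
left=> p q r p' q' r'; rewrite memS a0 b0 c0 !mul0r !addr0.
exact: eqP.
Qed.

(** Conjugation is injective, so an inclusion of the image between spaces of equal dimension is an
    equality. *)
Lemma so4_equiv_dim (S S' : {vspace 'M[K]_(2 + 2)}) (P Q : 'M[K]_2) :
  \det P = 1 -> \det Q = 1 -> \dim S = \dim S' ->
  (forall Z, Z \in S -> conjugation (block_mx P 0 0 Q) Z \in S') -> so4_equiv S S'.
Proof.
move=> detP detQ dimSS' sub; exists P, Q; split=> //.
apply/eqP; rewrite eqEdim; apply/andP; split.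
  by apply/subvP => _ /memv_imgP[Z ZS ->]; apply: sub.
by rewrite (dim_limg_inj (in2W (conjugation_inj detP detQ))) dimSS'.
Qed.

Lemma subalgebra5_classification (S : {vspace 'M[K]_(2 + 2)}) :
  so4_subalgebra S -> \dim S = 5 ->
  so4_equiv S (A1K2_1 K) \/ so4_equiv S (A1K2_2 K).
Proof.
move=> subS dim5; have [a [b [c [nz disc kerS]]]] := subalgebra5_functional subS dim5.
have [P detP triP] := isotropic_functional_conj two_neq0 nz disc.
have [_ _ dim1] := levi_A1K2_1 two_neq0; have [_ _ dim2] := levi_A1K2_2 two_neq0.
have det1 : \det (1%:M : 'M[K]_2) = 1 by rewrite det1.
have blocks Z : Z \in S -> exists p q r p' q' r',
    Z = block_mx (sl2mx p q r) 0 0 (sl2mx p' q' r').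
  case: subS => /(_ Z) inS _ /inS/in_so4P; rewrite so4E => /limg_blocksP[X [Y [->]]].
  case/sl2mxP=> p [q [r ->]] /sl2mxP[p' [q' [r' ->]]].
  by exists p, q, r, p', q', r'.
(* A constraint on the first component cuts the first factor down to a Borel subalgebra, which leads
   to the second normal form, and conversely. Only the constrained block is conjugated by $P$; the
   other one gets the identity. *)
case: kerS => kerS; [right|left].
  apply: (so4_equiv_dim detP det1); first by rewrite dim5 dim2.
  move=> Z ZS; have [p [q [r [p' [q' [r' EZ]]]]]] := blocks Z ZS; rewrite EZ in ZS *.
  rewrite conjugation_block // A1K2_2E mem_limg_blocks !conj_sl2 ?sl2mx_sl2 //.
  by rewrite mem_borel ?conj_sl2 ?sl2mx_sl2 // triP ?(kerS _ _ _ _ _ _ ZS) ?eqxx.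
apply: (so4_equiv_dim det1 detP); first by rewrite dim5 dim1.
move=> Z ZS; have [p [q [r [p' [q' [r' EZ]]]]]] := blocks Z ZS; rewrite EZ in ZS *.
rewrite conjugation_block // A1K2_1E mem_limg_blocks !conj_sl2 ?sl2mx_sl2 //.
by rewrite mem_borel ?conj_sl2 ?sl2mx_sl2 // triP ?(kerS _ _ _ _ _ _ ZS) ?eqxx.
Qed.

End Classification.

(** * The classification over the complex numbers *)

Local Open Scope complex_scope.

Theorem theorem7p3 (R : realType) :
  [/\ is_A1 (A1_1 R[i]), is_K2 (K2_1 R[i]) & lie_direct_sum (A1_1 R[i]) (K2_1 R[i])] /\
  [/\ is_A1 (A1_2 R[i]), is_K2 (K2_2 R[i]) & lie_direct_sum (A1_2 R[i]) (K2_2 R[i])] /\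
  levi_so4_dim 5 (A1K2_1 R[i]) /\
  levi_so4_dim 5 (A1K2_2 R[i]) /\
  ~ so4_equiv (A1K2_1 R[i]) (A1K2_2 R[i]) /\
  (forall S : {vspace 'M[R[i]]_(2 + 2)}, levi_so4_dim 5 S ->
     (so4_equiv S (A1K2_1 R[i]) /\ ~ so4_equiv S (A1K2_2 R[i])) \/
     (so4_equiv S (A1K2_2 R[i]) /\ ~ so4_equiv S (A1K2_1 R[i]))).
Proof.
have two_neq0 : 2 != 0 :> R[i] by rewrite Num.Theory.pnatr_eq0.
split; first by have [? _ ? ?] := A1K2_1_structure two_neq0.
split; first by have [? _ ? ?] := A1K2_2_structure two_neq0.
split; first exact: levi_A1K2_1.
split; first exact: levi_A1K2_2.
(* A subalgebra equivalent to the second form misses some element of the first factor, whereas the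
   first form contains that whole factor. *)
split=> [/equiv_A1K2_2_misses[X Xsl /negP[]]|S [subS _ dim5]].
  by rewrite A1K2_1E mem_limg_blocks Xsl mem0v.
have [S1|S2] := subalgebra5_classification two_neq0 subS dim5; [left|right].
  by split=> //; apply: not_equiv_both.
by split=> // S1; apply: not_equiv_both S2.
Qed.
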